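(* Let $\mathsf P$ be a potential graph on $\mathcal N$, $|\mathcal N|=N$, with barrier digraph $V$. There is an algorithm which, given the weights of $\mathsf P$, uses $O(N^2)$ operations in total and determines: a minimum-weight spanning entering tree of $V$ with root $q$ (an element of $\tilde{\mathcal T}^{\bullet q}_{\mathcal N}$) for every $q\in\mathcal N$, all the weights $\lambda^{\bullet q}_{\mathcal N}$, $q\in\mathcal N$, and a spanning entering tree of $V$ of minimum weight irrespective of the root (an element of $\tilde{\mathcal T}^{\bullet}_{\mathcal N}$). Namely, one takes any minimum-weight spanning tree $\mathsf T$ of the undirected graph $\mathsf P$ (found e.g. by Prim's algorithm); for each $q$ the entering tree $T_q$ obtained from $\mathsf T$ by assigning the root $q$ is in $\tilde{\mathcal T}^{\bullet q}_{\mathcal N}$, and for $y$ with $p_{yy}=\min_{t\in\mathcal N}p_{tt}$ the tree $T_y$ is in $\tilde{\mathcal T}^{\bullet}_{\mathcal N}$.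
   Context: A potential graph is a finite connected undirected graph $\mathsf P$ with vertex set $\mathcal N$ and edge set $\mathcal E\mathsf P$, with a loop at every vertex, whose edges and loops carry real weights $p_{ij}=p_{ji}$ (loops: $p_{ii}$). Its barrier digraph $V$ is the loopless digraph on $\mathcal N$ with an arc $(i,j)$, $i\neq j$, iff $(i,j)\in\mathcal E\mathsf P$, with arc weights $v_{ij}=p_{ij}-p_{ii}$. An entering tree is a digraph whose underlying graph is a tree, with at most one arc leaving each vertex; its root is the unique vertex with no outgoing arc. $\mathcal T^{\bullet q}_{\mathcal N}$ is the set of entering trees that are subgraphs of $V$ with vertex set $\mathcal N$ and root $q$; $\mathcal T^{\bullet}_{\mathcal N}=\bigcup_q\mathcal T^{\bullet q}_{\mathcal N}$. The weight of a directed tree $T$ is the sum $\Upsilon^T$ of $v_{ij}$ over its arcs; the weight of an undirected tree is the sum of $p_{ij}$ over its edges (trees contain no loops). $\lambda^{\bullet q}_{\mathcal N}=\min_{T\in\mathcal T^{\bullet q}_{\mathcal N}}\Upsilon^T$, and $\tilde{\mathcal T}^{\bullet q}_{\mathcal N}$, $\tilde{\mathcal T}^{\bullet}_{\mathcal N}$ are the subsets of minimum-weight trees in $\mathcal T^{\bullet q}_{\mathcal N}$, $\mathcal T^{\bullet}_{\mathcal N}$. Assigning root $q$ to an undirected tree $\mathsf T$ means orienting every edge towards $q$, an arc $(i,j)$ having weight $v_{ij}$. Operations are arithmetic operations and comparisons on weights and elementary list operations. *)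

(* Defs.v *)
From mathcomp Require Import all_boot all_order all_algebra.
From mathcomp Require Import reals.

Set Implicit Arguments.
Unset Strict Implicit.
Unset Printing Implicit Defensive.

Import Order.TTheory GRing.Theory Num.Theory.
Local Open Scope ring_scope.

(* Undirected edges on a finite vertex type T are sets of vertices: [set i; j]
   with i != j is an edge, and [set i] (which equals [set i; i]) is a loop. *)

Definition adj (T : finType) (E : {set {set T}}) : rel T :=
  fun i j => [set i; j] \in E.

(* The values of [weight] outside [edges] are irrelevant. *)
Record potential_graph (R : realType) (T : finType) := PotentialGraph {
  edges : {set {set T}};
  weight : {set T} -> R;
  edges_card : forall e, e \in edges -> (1 <= #|e| <= 2)%N;
  edges_loop : forall i : T, [set i] \in edges;
  vertices_neq0 : (0 < #|T|)%N;
  edges_connected : forall i j, connect (adj edges) i j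
}.

(* A tree whose vertex set is the whole of T. *)
Definition spanning_tree (T : finType) (F : {set {set T}}) : Prop :=
  [/\ forall e, e \in F -> #|e| = 2%N,
      forall i j, connect (adj F) i j
    & forall c : seq T, (2 < size c)%N -> ~ ucycle (adj F) c].

Definition tree_weight (R : realType) (T : finType) (P : potential_graph R T)
    (F : {set {set T}}) : R :=
  \sum_(e in F) weight P e.

Definition min_spanning_tree (R : realType) (T : finType)
    (P : potential_graph R T) (F : {set {set T}}) : Prop :=
  [/\ F \subset edges P, spanning_tree F
    & forall G : {set {set T}}, G \subset edges P -> spanning_tree G ->
        tree_weight P F <= tree_weight P G].

(* Digraphs on T are sets of arcs. *)

Definition barrier_arcs (R : realType) (T : finType) (P : potential_graph R T) :
    {set T * T} :=
  [set a | (a.1 != a.2) && ([set a.1; a.2] \in edges P)].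

Definition barrier_weight (R : realType) (T : finType) (P : potential_graph R T)
    (i j : T) : R :=
  weight P [set i; j] - weight P [set i].

Definition underlying (T : finType) (A : {set T * T}) : {set {set T}} :=
  [set [set a.1; a.2] | a in A].

Definition out_nbrs (T : finType) (A : {set T * T}) (i : T) : {set T} :=
  [set j | (i, j) \in A].

(* [underlying] merges antiparallel arcs; the last clause rules them out, since
   a tree on T has #|T|.-1 edges and only #|T|.-1 vertices emit an arc. *)
Definition entering_tree (T : finType) (q : T) (A : {set T * T}) : Prop :=
  [/\ spanning_tree (underlying A),
      forall i, (#|out_nbrs A i| <= 1)%N
    & forall i, (out_nbrs A i == set0) = (i == q)].

Definition rooted_tree (R : realType) (T : finType) (P : potential_graph R T)
    (q : T) (A : {set T * T}) : Prop :=
  A \subset barrier_arcs P /\ entering_tree q A.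

Definition arc_weight (R : realType) (T : finType) (P : potential_graph R T)
    (A : {set T * T}) : R :=
  \sum_(a in A) barrier_weight P a.1 a.2.

Definition min_rooted_tree (R : realType) (T : finType)
    (P : potential_graph R T) (q : T) (A : {set T * T}) : Prop :=
  rooted_tree P q A /\
  forall B : {set T * T}, rooted_tree P q B -> arc_weight P A <= arc_weight P B.

Definition min_tree (R : realType) (T : finType)
    (P : potential_graph R T) (A : {set T * T}) : Prop :=
  (exists q, rooted_tree P q A) /\
  forall (q : T) (B : {set T * T}),
    rooted_tree P q B -> arc_weight P A <= arc_weight P B.

(* l is the minimum of the weights of the entering trees rooted at q. *)
Definition is_min_weight (R : realType) (T : finType)
    (P : potential_graph R T) (q : T) (l : R) : Prop :=
  (exists2 A : {set T * T}, rooted_tree P q A & arc_weight P A = l) /\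
  forall B : {set T * T}, rooted_tree P q B -> l <= arc_weight P B.

(* Deleting the edge [set i; j] splits the tree F in two; the edge is directed
   from i to j when q is on the side of j. *)
Definition assign_root (T : finType) (F : {set {set T}}) (q : T) :
    {set T * T} :=
  [set a | ([set a.1; a.2] \in F) &&
           connect (adj (F :\ [set a.1; a.2])) a.2 q].

(* Algorithms are programs of a random-access machine with
   - registers and two-dimensional arrays of natural numbers (used as indices),
   - registers and two-dimensional arrays of weights.
   Registers and arrays are named by natural numbers, and the cell at (i, j) of
   the array k has the key (k, i, j).  Programs contain no weight constants, and
   weights are accessible only through addition, subtraction and comparison.
   Indices are only copied, incremented and compared, so no data can be packed
   into large numbers.  Every instruction and every evaluation of a test,
   whether on weights or on indices, is one operation. *)

Record state (R : realType) := State {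
  ireg : nat -> nat;
  icell : nat * nat * nat -> nat;
  wreg : nat -> R;
  wcell : nat * nat * nat -> R
}.

Inductive instr :=
| IConst (x n : nat)
| IMove (x y : nat)
| ISucc (x y : nat)
| ILoad (x k i j : nat)
| IStore (k i j x : nat)
| WMove (u v : nat)
| WAdd (u v w : nat)
| WSub (u v w : nat)
| WLoad (u k i j : nat)
| WStore (k i j u : nat).

Inductive test :=
| IEq (x y : nat)
| ILt (x y : nat)
| WLt (u v : nat).

Inductive prog :=
| Instr (c : instr)
| Seq (c d : prog)
| If (t : test) (c d : prog)
| While (t : test) (c : prog).

Definition upd (K : eqType) (V : Type) (f : K -> V) (k : K) (v : V) : K -> V :=
  fun k' => if k' == k then v else f k'.

Definition set_ireg (R : realType) (s : state R) (x n : nat) : state R :=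
  State (upd (ireg s) x n) (icell s) (wreg s) (wcell s).

Definition set_wreg (R : realType) (s : state R) (u : nat) (r : R) : state R :=
  State (ireg s) (icell s) (upd (wreg s) u r) (wcell s).

(* In array accesses i and j name the registers holding the row and the
   column; the array name k is literal. *)
Definition step (R : realType) (c : instr) (s : state R) : state R :=
  match c with
  | IConst x n => set_ireg s x n
  | IMove x y => set_ireg s x (ireg s y)
  | ISucc x y => set_ireg s x (ireg s y).+1
  | ILoad x k i j => set_ireg s x (icell s (k, ireg s i, ireg s j))
  | IStore k i j x =>
      State (ireg s) (upd (icell s) (k, ireg s i, ireg s j) (ireg s x))
            (wreg s) (wcell s)
  | WMove u v => set_wreg s u (wreg s v)
  | WAdd u v w => set_wreg s u (wreg s v + wreg s w)
  | WSub u v w => set_wreg s u (wreg s v - wreg s w)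
  | WLoad u k i j => set_wreg s u (wcell s (k, ireg s i, ireg s j))
  | WStore k i j u =>
      State (ireg s) (icell s) (wreg s)
            (upd (wcell s) (k, ireg s i, ireg s j) (wreg s u))
  end.

Definition holds (R : realType) (t : test) (s : state R) : bool :=
  match t with
  | IEq x y => ireg s x == ireg s y
  | ILt x y => (ireg s x < ireg s y)%N
  | WLt u v => wreg s u < wreg s v
  end.

(* [exec c s n s']: started in s, the program c halts in s' after n
   operations. *)
Inductive exec (R : realType) : prog -> state R -> nat -> state R -> Prop :=
| ExecInstr c s : exec (Instr c) s 1%N (step c s)
| ExecSeq c d s1 s2 s3 m n :
    exec c s1 m s2 -> exec d s2 n s3 -> exec (Seq c d) s1 (m + n)%N s3
| ExecIf t c d s s' n :
    exec (if holds t s then c else d) s n s' -> exec (If t c d) s n.+1 s'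
| ExecWhileStop t c s :
    ~~ holds t s -> exec (While t c) s 1%N s
| ExecWhileStep t c s1 s2 s3 m n :
    holds t s1 -> exec c s1 m s2 -> exec (While t c) s2 n s3 ->
    exec (While t c) s1 (m + n).+1%N s3.

(* Vertices are numbered by enum_rank.  Initially register 0 holds the number of
   vertices, index array 0 the adjacency matrix (1 for an edge or loop, 0
   otherwise), and weight array 0 the weights of the edges and loops.  The rest
   of the memory is uninitialized, hence arbitrary. *)
Definition input_state (R : realType) (T : finType) (P : potential_graph R T)
    (s : state R) : Prop :=
  [/\ ireg s 0%N = #|T|,
      forall i j : T, icell s (0%N, enum_rank i : nat, enum_rank j : nat) =
                      ([set i; j] \in edges P)
    & forall i j : T, [set i; j] \in edges P ->
        wcell s (0%N, enum_rank i : nat, enum_rank j : nat) =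
        weight P [set i; j]].

(* Row r of index array k, read as a digraph in which i emits an arc to the
   vertex whose number is in column i; a vertex emits no arc when that entry is
   its own number (or is not the number of a vertex). *)
Definition read_tree (R : realType) (T : finType) (s : state R) (k r : nat) :
    {set T * T} :=
  [set a | (a.1 != a.2) &&
           (icell s (k, r, enum_rank a.1 : nat) == enum_rank a.2)].

(* Row q of index array 1 holds the tree with root q, entry (q, 0) of weight
   array 1 holds its weight, and row 0 of index array 2 holds the tree that is
   optimal irrespective of the root.  All these trees are orientations of one
   minimum-weight spanning tree F. *)
Definition output_state (R : realType) (T : finType) (P : potential_graph R T)
    (s : state R) : Prop :=
  exists2 F : {set {set T}}, min_spanning_tree P F &
    (forall q : T,
       [/\ min_rooted_tree P q (read_tree T s 1%N (enum_rank q)),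
           read_tree T s 1%N (enum_rank q) = assign_root F q
         & is_min_weight P q (wcell s (1%N, enum_rank q : nat, 0%N))]) /\
    (min_tree P (read_tree T s 2%N 0%N) /\
     exists2 y : T, forall t : T, weight P [set y] <= weight P [set t] &
       read_tree T s 2%N 0%N = assign_root F y).

(* Main.v *)
Require Import Defs.
From mathcomp Require Import all_boot all_order all_algebra.
From mathcomp Require Import reals zify.

Set Implicit Arguments.
Unset Strict Implicit.
Unset Printing Implicit Defensive.

Import Order.TTheory GRing.Theory Num.Theory.
Local Open Scope ring_scope.

(* A spanning tree rooted at q is a parent function f with f q = q along which
   some rank decreases, and its arcs weigh as much as the underlying undirected
   tree minus the loop weights of all vertices but q.  So on a fixed root the arc
   weight differs from the undirected weight by a constant, orienting a minimum
   spanning tree towards q is optimal, and the root costs only its loop weight.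

   The program is the dense version of Prim's algorithm.  When it joins u to the
   tree S by the edge {b, u}, it also updates the rows of all rooted trees in
   O(N) operations: u becomes a child of b in every row r of S, and the row of u
   is the row of b in which b becomes a child of u. *)

(** * Parent functions and spanning trees *)

(** Acyclicity stated through [ucycle] gives no direct handle on counts, sums or paths. A parent
    function does: each non-root vertex is matched with the edge to its parent, and induction on the
    rank replaces reasoning about paths. Rerooting is cheap because every root keeps its own row:
    the row of [b] is already rooted at [b], so placing [u] above it changes only the entries of [b]
    and [u], with no path to reverse. Functions and rows are constrained only on the current vertex
    set [S], since the remaining memory is arbitrary. *)

Definition parent_fun (T : finType) (S : {set T}) (q : T) (f : T -> T) : Prop :=
  [/\ q \in S, f q = q, {in S, forall x, f x \in S}
    & exists d : T -> nat, {in S, forall x, x != q -> (d (f x) < d x)%N}].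

Definition fun_edges (T : finType) (S : {set T}) (f : T -> T) : {set {set T}} :=
  [set [set x; f x] | x in S & f x != x].

Definition fun_arcs (T : finType) (f : T -> T) : {set T * T} :=
  [set a | (a.1 != a.2) && (f a.1 == a.2)].

Section Graph.
Variable T : finType.
Implicit Types (S : {set T}) (f g : T -> T) (q u b x y : T) (F G E : {set {set T}}).

Lemma set2_eq x y u b :
  [set x; y] = [set u; b] -> (x = u /\ y = b) \/ (x = b /\ y = u).
Proof.
move=> e; have := set21 x y; have := set22 x y; have := set21 u b; have := set22 u b.
rewrite -{1 2}e {3 4}e !inE => /orP[]/eqP bE /orP[]/eqP uE /orP[]/eqP yE /orP[]/eqP xE;
  by [left; split; congruence | right; split; congruence].
Qed.

Lemma set2_neq_card x y : x != y -> #|[set x; y]| = 2%N.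
Proof. by rewrite cards2 => ->. Qed.

Lemma adj_sym E : symmetric (adj E).
Proof. by move=> x y; rewrite /adj setUC. Qed.

Lemma connect_adj_sym E : connect_sym (adj E).
Proof. by apply: sym_connect_sym; apply: adj_sym. Qed.

Lemma connected_cross (e : rel T) S q y :
  connect e q y -> q \in S -> y \notin S ->
  exists x z, [/\ x \in S, z \notin S & e x z].
Proof.
move=> /connectP[p]; elim: p q => [|z p IH] q /=.
  by move=> _ -> ->.
move=> /andP[qz pz] yl qS yS.
have [zS|zS] := boolP (z \in S); last by exists q, z.
exact: IH pz yl zS yS.
Qed.

Lemma connect_ind (e : rel T) (Q : T -> Prop) x y :
  connect e x y -> Q x -> (forall a b, Q a -> e a b -> Q b) -> Q y.
Proof.
move=> /connectP[p + ->] + IH; elim: p x => //= z p IHp x /andP[xz pz] Qx.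
exact: IHp pz (IH _ _ Qx xz).
Qed.

Lemma parent_fun_fix S q f x :
  parent_fun S q f -> x \in S -> (f x == x) = (x == q).
Proof.
case=> qS fq fS [d dP] xS; have [->|nxq] := eqVneq x q; first by rewrite fq eqxx.
by apply/eqP => fx; have := dP x xS nxq; rewrite fx ltnn.
Qed.

Lemma fun_edges_card2 S f e : e \in fun_edges S f -> #|e| = 2%N.
Proof.
by case/imsetP=> x; rewrite inE => /andP[_ nfx] ->; rewrite set2_neq_card // eq_sym.
Qed.

(** If the two edges agreed crosswise, [x] and [y] would be parents of each other and the rank would
    drop twice around a 2-cycle. This injectivity is what lets edges be counted, and sums over edges
    be reindexed, by non-root vertices. *)
Lemma parent_fun_inj S q f x y :
  parent_fun S q f -> x \in S -> y \in S -> x != q -> y != q ->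
  [set x; f x] = [set y; f y] -> x = y.
Proof.
case=> _ _ _ [d dP] xS yS xq yq /set2_eq[[]//|[xy yx]].
by have := dP x xS xq; have := dP y yS yq; rewrite yx -xy => /ltn_trans h /h; rewrite ltnn.
Qed.

Lemma fun_dom S q f : parent_fun S q f -> [set x in S | f x != x] = S :\ q.
Proof.
move=> pf; apply/setP => x; rewrite !inE andbC.
by case: (boolP (x \in S)) => xS; rewrite ?andbF // (parent_fun_fix pf).
Qed.

Lemma fun_edgesE S q f : parent_fun S q f ->
  fun_edges S f = [set [set x; f x] | x in S :\ q].
Proof.
move=> pf; rewrite -(fun_dom pf); apply/setP => e.
by apply/imsetP/imsetP => -[x]; rewrite ?inE => xP ->; exists x; rewrite ?inE.
Qed.

Lemma mem_fun_edges S q f x : parent_fun S q f -> x \in S -> x != q ->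
  [set x; f x] \in fun_edges S f.
Proof.
by move=> pf xS xq; rewrite (fun_edgesE pf); apply: imset_f; rewrite !inE xq.
Qed.

Lemma fun_edgesP S q f x y : parent_fun S q f ->
  [set x; y] \in fun_edges S f ->
  (x \in S /\ x != q /\ y = f x) \/ (y \in S /\ y != q /\ x = f y).
Proof.
move=> pf; rewrite (fun_edgesE pf) => /imsetP[z]; rewrite !inE => /andP[zq zS].
by case/set2_eq => -[-> ->]; [left|right].
Qed.

Lemma card_fun_edges S q f : parent_fun S q f -> #|fun_edges S f| = #|S|.-1.
Proof.
move=> pf; rewrite (fun_edgesE pf) card_in_imset; last first.
  move=> x y; rewrite !inE => /andP[xq xS] /andP[yq yS]; exact: (parent_fun_inj pf).
by rewrite (cardsD1 q S); case: pf => ->.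
Qed.

Lemma parent_fun_leaf S q f u b : parent_fun S q f -> u \notin S -> b \in S ->
  parent_fun (u |: S) q (fun x => if x == u then b else f x).
Proof.
move=> [qS fq fS [d dP]] uS bS; have neu x : x \in S -> (x == u) = false.
  by move=> xS; apply/negP => /eqP xu; rewrite -xu xS in uS.
split; first by rewrite !inE qS orbT.
- by rewrite neu.
- move=> x; rewrite !inE; case: eqVneq => [_ _|_] /=; first by rewrite bS orbT.
  by move=> /fS->; rewrite orbT.
exists (fun x => if x == u then (d b).+1 else d x) => x.
rewrite !inE; case: eqVneq => [_ _ _|_] /=; first by rewrite (neu b) // eqxx.
by move=> xS xq; rewrite neu ?fS ?dP.
Qed.

(** The old root [b] is the only old vertex whose parent changes. All old ranks go up by one to
    leave rank 0 to [u]. *)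
Lemma parent_fun_reroot S f u b : parent_fun S b f -> u \notin S ->
  parent_fun (u |: S) u (fun x => if (x == b) || (x == u) then u else f x).
Proof.
move=> [bS fb fS [d dP]] uS; have neu x : x \in S -> (x == u) = false.
  by move=> xS; apply/negP => /eqP xu; rewrite -xu xS in uS.
split; first by rewrite !inE eqxx.
- by rewrite eqxx orbT.
- move=> x; rewrite !inE; case: (boolP ((x == b) || _)) => [_ _|]; first by rewrite eqxx.
  by rewrite negb_or => /andP[_ /negPf->] /= /fS->; rewrite orbT.
exists (fun x => if x == u then 0%N else (d x).+1) => x.
rewrite !inE; case: eqVneq => //= _ xS _; rewrite orbF.
case: (eqVneq x b) => [|nxb]; first by rewrite eqxx.
by rewrite neu ?fS // ltnS dP.
Qed.

Lemma fun_edges_leaf S q f u b : parent_fun S q f -> u \notin S -> b \in S ->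
  fun_edges (u |: S) (fun x => if x == u then b else f x)
  = [set b; u] |: fun_edges S f.
Proof.
move=> pf uS bS; rewrite (fun_edgesE (parent_fun_leaf pf uS bS)) (fun_edgesE pf).
have uq : u != q by apply: contraNneq uS => ->; case: pf.
rewrite setDUl imsetU.
have -> : [set u] :\ q = [set u].
  by apply/setP => x; rewrite !inE; case: (eqVneq x u) => [->|]; rewrite ?uq ?andbF.
rewrite imset_set1 eqxx [[set u; b]]setUC; congr (_ :|: _).
apply: eq_in_imset => x; rewrite !inE => /andP[_ xS].
by case: eqVneq => // xu; rewrite -xu xS in uS.
Qed.

Lemma fun_edges_reroot S f u b : parent_fun S b f -> u \notin S ->
  fun_edges (u |: S) (fun x => if (x == b) || (x == u) then u else f x)
  = [set b; u] |: fun_edges S f.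
Proof.
move=> pf uS; rewrite (fun_edgesE (parent_fun_reroot pf uS)) (fun_edgesE pf).
have bS : b \in S by case: pf.
have -> : (u |: S) :\ u = b |: (S :\ b).
  by rewrite setU1K // setD1K.
rewrite imsetU imset_set1 eqxx /=; congr (_ :|: _).
apply: eq_in_imset => x; rewrite !inE => /andP[/negPf-> xS] /=.
by case: eqVneq => // xu; rewrite -xu xS in uS.
Qed.

Lemma parent_fun1 u : parent_fun [set u] u id.
Proof.
by split; rewrite ?inE //; exists (fun=> 0%N) => x; rewrite !inE => /eqP-> /eqP.
Qed.

Lemma fun_edges_id S : fun_edges S id = set0.
Proof.
by apply/eqP/set0Pn => -[e /imsetP[x]]; rewrite inE eqxx andbF.
Qed.

(** A tree is grown from [q] by hanging on leaves across edges of [E] that leave the current vertex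
    set; connectedness supplies such an edge as long as a vertex is missing. *)
Lemma parent_fun_ex E q : (forall i j, connect (adj E) i j) ->
  exists2 f, parent_fun [set: T] q f & fun_edges [set: T] f \subset E.
Proof.
move=> cE.
suff H n : (n < #|T|)%N -> exists S f,
    [/\ #|S| = n.+1, parent_fun S q f & fun_edges S f \subset E].
  have T0 : (0 < #|T|)%N by apply/card_gt0P; exists q.
  have [|S [f [cS pf sE]]] := H #|T|.-1; first by rewrite prednK.
  have eS : S = [set: T].
    by apply/eqP; rewrite eqEcard subsetT cardsT cS prednK ?leqnn.
  by exists f; rewrite -eS.
elim: n => [_|n IH ltn].
  exists [set q], id; rewrite cards1 fun_edges_id sub0set; split=> //.
  exact: parent_fun1.
have [S [f [cS pf sE]]] := IH (ltnW ltn).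
have /subsetPn[y _ yS] : ~~ ([set: T] \subset S).
  by apply: contraL ltn => /subset_leq_card; rewrite cardsT cS -leqNgt.
have qS : q \in S by case: pf.
have [x [z [xS zS exz]]] := connected_cross (cE q y) qS yS.
exists (z |: S), (fun v => if v == z then x else f v); split.
- by rewrite cardsU1 zS cS.
- exact: parent_fun_leaf.
- by rewrite (fun_edges_leaf pf) // subUset sub1set sE andbT.
Qed.

(** Climbing from [x] only meets vertices of rank at most [d x], so only their edges have to be in
    [E]. The restriction matters where [E] is a tree from which an edge higher in rank was
    deleted. *)
Lemma rank_connect q f (d : T -> nat) E x :
  (forall z, z != q -> (d (f z) < d z)%N) ->
  (forall z, z != q -> (d z <= d x)%N -> [set z; f z] \in E) ->
  connect (adj E) x q.
Proof.
move=> dP; have [m] := ubnP (d x); elim: m x => // m IH x dx xE.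
have [->|xq] := eqVneq x q; first exact: connect0.
apply: connect_trans (connect1 (xE x xq (leqnn _))) (IH (f x) _ _).
  exact: leq_trans (dP x xq) _.
by move=> z zq zx; apply: xE => //; apply: leq_trans zx (ltnW (dP x xq)).
Qed.

Lemma fun_edges_connect q f : parent_fun [set: T] q f ->
  forall i j, connect (adj (fun_edges [set: T] f)) i j.
Proof.
move=> pf; have cq i : connect (adj (fun_edges [set: T] f)) i q.
  case: (pf) => _ _ _ [d dP]; apply: (rank_connect (f := f) (d := d)) => [z|z zq _].
    exact: dP.
  by rewrite (mem_fun_edges pf).
by move=> i j; apply: connect_trans (cq i) _; rewrite connect_adj_sym.
Qed.

(* In a cycle, both neighbours of a vertex of maximal rank must be its parent. *)
Lemma fun_edges_acyclic q f (c : seq T) : parent_fun [set: T] q f ->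
  (2 < size c)%N -> ~ ucycle (adj (fun_edges [set: T] f)) c.
Proof.
move=> pf c2 /andP[cc uc]; case: (pf) => _ _ _ [d dP].
have [x0 x0c] : exists x, x \in c by case: c c2 {cc uc} => // x c; exists x; rewrite inE eqxx.
have [x xc xmax] := @arg_maxnP T x0 [in c] d x0c.
have par y : y \in c -> adj (fun_edges [set: T] f) x y -> y = f x.
  move=> yc /(fun_edgesP pf)[[_ [_ ->]]//|[yS [yq xy]]].
  by have := dP y yS yq; rewrite -xy ltnNge; have /= -> := xmax y yc.
have nx : next c x = f x by apply: par; rewrite ?mem_next // next_cycle.
have px : prev c x = f x.
  by apply: par; rewrite ?mem_prev // adj_sym prev_cycle.
have nf : next c (f x) = x by rewrite -px next_prev.
(* Rotated to start at [x], the cycle goes from [x] to [f x] and straight back to [x], so it has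
   length two. *)
have [i c' rc] := rot_to xc.
have ur : uniq (rot i c) by rewrite rot_uniq.
move: nx nf c2 ur; rewrite -!(next_rot i uc) -(size_rot i) {}rc.
case: c' => [|y [|z c']] //=; rewrite eqxx => <- + _.
rewrite eqxx; case: eqVneq => [->|_ zx]; first by rewrite !inE eqxx.
by rewrite zx !inE eqxx !orbT.
Qed.

(* An edge of F off the tree would close a cycle. *)
Lemma spanning_tree_parent_fun F q : spanning_tree F ->
  exists2 f, parent_fun [set: T] q f & fun_edges [set: T] f = F.
Proof.
case=> F2 cF aF; have [f pf sF] := parent_fun_ex q cF.
exists f => //; apply/eqP; rewrite eqEsubset sF /=; apply/subsetP => e eF.
have /eqP/cards2P[x [y [nxy ee]]] := F2 e eF.
have /connectP[p0 p0P yE] := fun_edges_connect pf x y.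
apply: contraT => en; case/shortenP: p0P yE => p pP up _ yE.
case: (aF (x :: p)); last first.
  rewrite /ucycle up andbT /= rcons_path -yE (sub_path _ pP) /=.
    by rewrite /adj setUC -ee.
  by move=> u v; apply: (subsetP sF).
(* The closed path is too short to be a cycle only if [p] is empty, against [x != y], or is a single
   edge, which is then [e] itself. *)
case: p pP {up} yE => [|z [|w p]] //= => [_ yx|/andP[xz _] yz].
  by rewrite yx eqxx in nxy.
by case/negP: en; rewrite ee yz.
Qed.

Lemma fun_edges_spanning q f :
  parent_fun [set: T] q f -> spanning_tree (fun_edges [set: T] f).
Proof.
move=> pf; split; [exact: fun_edges_card2 | exact: fun_edges_connect pf |].
by move=> c; apply: fun_edges_acyclic pf.
Qed.

Lemma card_spanning_tree F : spanning_tree F -> #|F| = #|T|.-1.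
Proof.
move=> sF; have [/card0_eq T0|/card_gt0P[q _]] := posnP #|T|; last first.
  by have [f pf <-] := spanning_tree_parent_fun q sF; rewrite (card_fun_edges pf) cardsT.
case: sF => F2 _ _; rewrite [#|T|]eq_card0 //; apply: eq_card0 => e.
apply/negP => /F2 e2; have /card_gt0P[x _] : (0 < #|e|)%N by rewrite e2.
by have := T0 x; rewrite inE.
Qed.

(** A connected graph contains a spanning tree, and equal edge counts force equality. This spares a
    direct check of acyclicity. *)
Lemma spanning_tree_card F q : (forall i j, connect (adj F) i j) ->
  #|F| = #|T|.-1 -> spanning_tree F.
Proof.
move=> cF F1; have [f pf sF] := parent_fun_ex q cF.
suff <- : fun_edges [set: T] f = F by apply: fun_edges_spanning pf.
by apply/eqP; rewrite eqEcard sF F1 (card_fun_edges pf) cardsT leqnn.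
Qed.

(** * Orientations of spanning trees as parent functions *)

Lemma iter_fix (f : T -> T) q n : f q = q -> iter n f q = q.
Proof. by move=> fq; elim: n => //= n ->. Qed.

Lemma parent_fun_iter q f x : parent_fun [set: T] q f -> exists n, iter n f x = q.
Proof.
case=> _ _ _ [d dP]; have [m] := ubnP (d x); elim: m x => // m IH x dx.
have [->|xq] := eqVneq x q; first by exists 0%N.
have [|n nq] := IH (f x); first exact: leq_trans (dP x (in_setT x) xq) _.
by exists n.+1; rewrite iterSr.
Qed.

(** Deleting the edge between [x] and its parent leaves [f x] connected to [q], because the edges
    above [f x] belong to vertices of rank below [d x]. On the other side, only descendants of the
    child can be reached from it, and [q], being fixed by [f], is not one of them. *)
Lemma assign_root_parent_fun q f : parent_fun [set: T] q f ->
  assign_root (fun_edges [set: T] f) q = fun_arcs f.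
Proof.
move=> pf; case: (pf) => _ fq _ [d dP].
apply/setP => -[x y]; rewrite !inE /=; apply/andP/andP => [[xyE yq]|[nxy /eqP fx]].
  have nxy : x != y by have := fun_edges_card2 xyE; rewrite cards2; case: eqVneq.
  split=> //; case/(fun_edgesP pf): xyE => -[_ [xq fx]]; first by rewrite fx.
  have [||n] := @connect_ind _ (fun z => exists n, iter n f z = y) _ _ yq.
  - by exists 0%N.
  - move=> a b [n an] /setD1P[abn /(fun_edgesP pf)[[_ [_ bE]]|[_ [_ aE]]]].
      case: n an => [/= ay|n]; last by rewrite iterSr -bE; exists n.
      by rewrite bE ay -fx setUC eqxx in abn.
    by exists n.+1; rewrite iterSr -aE.
  by rewrite iter_fix // => qy; rewrite qy eqxx in xq.
have xq : x != q by apply: contraNneq nxy => xq; rewrite -fx xq fq.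
rewrite -fx; split; first exact: (mem_fun_edges pf).
apply: (rank_connect (f := f) (d := d)) => [z|z zq dz]; first exact: dP.
rewrite !inE (mem_fun_edges pf) // andbT; apply: contraTneq dz => e.
by rewrite (parent_fun_inj pf _ _ zq xq e) // -ltnNge dP.
Qed.

Lemma mem_out_nbrs_fun_arcs f x y :
  (y \in out_nbrs (fun_arcs f) x) = (x != y) && (f x == y).
Proof. by rewrite !inE. Qed.

Lemma underlying_fun_arcs f : underlying (fun_arcs f) = fun_edges [set: T] f.
Proof.
apply/setP => e; apply/imsetP/imsetP => [[[x y]]|[x]]; rewrite !inE /=.
  by case/andP=> nxy /eqP fx ->; exists x; rewrite ?inE fx // eq_sym.
by move=> nfx ->; exists (x, f x); rewrite ?inE //= eqxx eq_sym nfx.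
Qed.

Lemma entering_tree_fun_arcs q f :
  parent_fun [set: T] q f -> entering_tree q (fun_arcs f).
Proof.
move=> pf; split; first by rewrite underlying_fun_arcs; apply: fun_edges_spanning pf.
  move=> x; rewrite -(cards1 (f x)); apply/subset_leq_card/subsetP => y.
  by rewrite mem_out_nbrs_fun_arcs in_set1 [y == _]eq_sym => /andP[].
move=> x; rewrite -(parent_fun_fix pf (in_setT x)); apply/eqP/eqP => [/setP/(_ (f x))|fx].
  by rewrite mem_out_nbrs_fun_arcs inE eqxx andbT => /negbFE/eqP.
by apply/setP => y; rewrite mem_out_nbrs_fun_arcs inE fx andNb.
Qed.

(** The parent is the head of the outgoing arc, and the rank is the least number of steps to [q].
    That [q] is reached follows by induction along an undirected path from [q]: each edge of the
    path either adds one step or leads to the next iterate. *)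
Lemma entering_tree_parent_fun q (A : {set T * T}) : entering_tree q A ->
  exists2 f, parent_fun [set: T] q f & A = fun_arcs f.
Proof.
case=> -[U2 Uc _] out1 out0.
pose f x := odflt x [pick y in out_nbrs A x].
have fP x y : (x, y) \in A -> f x = y.
  move=> xy; rewrite /f; case: pickP => [z zx|/(_ y)] /=; last by rewrite !inE xy.
  by apply: (card_le1_eqP (out1 x)); rewrite // inE.
have fA x : x != q -> (x, f x) \in A.
  rewrite -out0 => /set0Pn[y]; rewrite inE => xy; by rewrite (fP x y).
have fq : f q = q.
  rewrite /f; case: pickP => //= y yq; have := out0 q; rewrite eqxx => /eqP/setP/(_ y).
  by rewrite yq inE.
have loop x : (x, x) \notin A.
  apply/negP => xx; have := U2 [set x; x]; rewrite cards2 eqxx => H.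
  by have := H (imset_f (fun a => [set a.1; a.2]) xx).
have reach x : exists n, iter n f x == q.
  have [||n nq] := @connect_ind _ (fun z => exists n, iter n f z = q) _ _ (Uc q x).
  - by exists 0%N.
  - move=> a b [n an] /imsetP[[c d] cd /set2_eq[[? ?]|[? ?]]]; subst a b; have /= := fP _ _ cd.
      (* With [n = 0] the arc would leave [q]; as [f q = q], it would be a loop. *)
      case: n an => [/= cq|n]; last by rewrite iterSr => <- ->; exists n.
      by move=> fc; case/negP: (loop q); move: cd; rewrite -fc cq fq.
    by move=> e; exists n.+1; rewrite iterSr e.
  by exists n; apply/eqP.
exists f.
  split=> //; exists (fun x => ex_minn (reach x)) => x _ xq.
  case: (ex_minnP (reach x)) => [[|n]] /=; first by rewrite (negPf xq).
  rewrite -iterS iterSr => nq _; case: ex_minnP => m _ /(_ n nq); by rewrite ltnS.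
apply/setP => -[x y]; rewrite inE /=; apply/idP/andP => [xy|[nxy /eqP fx]].
  by rewrite (fP _ _ xy) eqxx; split=> //; apply: contraNneq (loop x) => {2}->.
by rewrite -fx; apply: fA; apply: contraNneq nxy => xq; rewrite -fx xq fq.
Qed.

End Graph.

(** * Weights of rooted trees and the exchange step *)

Section Weights.
Variables (R : realType) (T : finType) (P : potential_graph R T).
Implicit Types (S : {set T}) (f g : T -> T) (q u b x y : T) (F G : {set {set T}}).
Local Notation w i j := (weight P [set i; j]).
Local Notation w0 i := (weight P [set i]).

Lemma fun_arcs_sub f : (fun_arcs f \subset barrier_arcs P) =
  (fun_edges [set: T] f \subset edges P).
Proof.
apply/subsetP/subsetP => sub e.
  case/imsetP=> x; rewrite !inE /= => nfx ->.
  have := sub (x, f x); rewrite !inE /= eqxx eq_sym nfx => H.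
  by have /andP[] := H isT.
case: e => x y; rewrite !inE /= => /andP[nxy /eqP fx]; rewrite nxy /=; apply: sub.
by rewrite -fx; apply: imset_f; rewrite !inE /= fx eq_sym.
Qed.

Lemma rooted_treeP q (A : {set T * T}) : rooted_tree P q A <->
  exists2 f, parent_fun [set: T] q f /\ fun_edges [set: T] f \subset edges P
           & A = fun_arcs f.
Proof.
split=> [[sA eA]|[f [pf sf] ->]].
  have [f pf Af] := entering_tree_parent_fun eA.
  by exists f => //; split; rewrite // -fun_arcs_sub -Af.
by split; [rewrite fun_arcs_sub | exact: entering_tree_fun_arcs].
Qed.

Lemma arc_weight_fun_arcs q f : parent_fun [set: T] q f ->
  arc_weight P (fun_arcs f) =
  tree_weight P (fun_edges [set: T] f) - \sum_x w0 x + w0 q.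
Proof.
move=> pf; have arcsE : fun_arcs f = [set (x, f x) | x in [set: T] :\ q].
  apply/setP => -[x y]; rewrite inE /=; apply/andP/imsetP => [[nxy /eqP fx]|[z]].
    exists x; rewrite ?fx // !inE andbT; apply: contraNneq nxy => xq.
    by rewrite -fx xq; case: pf => _ ->.
  rewrite !inE andbT => zq [-> ->]; rewrite eqxx eq_sym.
  by rewrite (parent_fun_fix pf).
rewrite /arc_weight arcsE big_imset /=; last by move=> x y _ _ [].
rewrite /tree_weight (fun_edgesE pf) big_imset /=; last first.
  by move=> x y; rewrite !inE !andbT => xq yq; apply: (parent_fun_inj pf).
rewrite sumrB [\sum_x w0 x](bigD1 q) //= opprD addrA addrAC addrNK; congr (_ - _).
by apply: eq_bigl => x; rewrite !inE andbT.
Qed.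

Lemma min_rooted_tree_assign_root F q :
  min_spanning_tree P F -> min_rooted_tree P q (assign_root F q).
Proof.
case=> sF tF minF; have [f pf Ff] := spanning_tree_parent_fun q tF; subst F.
rewrite (assign_root_parent_fun pf); split; first by apply/rooted_treeP; exists f.
move=> B /rooted_treeP[g [pg sg] ->].
rewrite (arc_weight_fun_arcs pf) (arc_weight_fun_arcs pg) !lerD2r.
by apply: minF => //; apply: fun_edges_spanning pg.
Qed.

Lemma arc_weight_assign_root F q : spanning_tree F ->
  arc_weight P (assign_root F q) = tree_weight P F - \sum_x w0 x + w0 q.
Proof.
move=> tF; have [f pf Ff] := spanning_tree_parent_fun q tF; subst F.
by rewrite (assign_root_parent_fun pf) (arc_weight_fun_arcs pf).
Qed.

Lemma min_tree_assign_root F y : min_spanning_tree P F ->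
  (forall t, w0 y <= w0 t) -> min_tree P (assign_root F y).
Proof.
move=> mF y0; have [ty _] := min_rooted_tree_assign_root y mF.
split; first by exists y.
move=> q B tB; have [_ /(_ B tB)] := min_rooted_tree_assign_root q mF.
case: mF => _ tF _; apply: le_trans.
by rewrite !arc_weight_assign_root // lerD2l.
Qed.

Lemma min_spanning_tree_ex : exists F, min_spanning_tree P F.
Proof.
have /card_gt0P[q _] := vertices_neq0 P.
have [f0 pf0 sf0] := parent_fun_ex q (@edges_connected _ _ P).
(* [spanning_tree] quantifies over all sequences; connectedness with an edge count is an equivalent
   boolean predicate, over which a minimum can be taken. *)
pose sp G := [&& G \subset edges P, [forall i, forall j, connect (adj G) i j]
               & #|G| == #|T|.-1].
have spP G : sp G <-> G \subset edges P /\ spanning_tree G.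
  split=> [/and3P[sG cG /eqP G1]|[sG tG]].
    split=> //; apply: (spanning_tree_card q) => // i j.
    by have /forallP/(_ i)/forallP/(_ j) := cG.
  apply/and3P; split=> //; last by rewrite (card_spanning_tree tG).
  by apply/forallP => i; apply/forallP => j; case: tG.
have sp0 : sp (fun_edges [set: T] f0) by apply/spP; split=> //; apply: fun_edges_spanning pf0.
case: (Order.TotalTheory.arg_minP (tree_weight P) sp0) => F /spP[sF tF] minF.
by exists F; split=> // G sG tG; apply/minF/spP.
Qed.

(* Prim's exchange step: the path joining b to u in F leaves S by some edge, which
   is exchanged for the lightest edge leaving S. *)
Lemma min_spanning_tree_exchange F S (A : {set {set T}}) b u :
  min_spanning_tree P F -> A \subset F -> {in A, forall e : {set T}, e \subset S} ->
  b \in S -> u \notin S -> [set b; u] \in edges P ->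
  (forall x y, x \in S -> y \notin S -> [set x; y] \in edges P -> w b u <= w x y) ->
  exists2 G, min_spanning_tree P G & [set b; u] |: A \subset G.
Proof.
move=> mF AF AS bS uS buE bu_min; have [sF tF minF] := mF.
have [f pf Ff] := spanning_tree_parent_fun b tF; subst F; case: (pf) => _ fb _ [d dP].
have exS : exists n, iter n f u \in S.
  by have [n nb] := parent_fun_iter u pf; exists n; rewrite nb.
case: (ex_minnP exS) => -[|k] kS kmin; first by rewrite /= (negPf uS) in kS.
(* Climbing from [u] to the root [b], the first vertex of [S] is met after [k.+1] steps. So [x] is
   the last vertex outside [S], and the edge from [x] to [f x] is the one to give up. *)
set x := iter k f u; have xS : x \notin S.
  by apply/negP => /kmin; rewrite ltnn.
have fxS : f x \in S by [].
have xb : x != b by apply: contraNneq xS => ->.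
have xfF : [set x; f x] \in fun_edges [set: T] f by apply: (mem_fun_edges pf).
have [e0|ne] := eqVneq [set x; f x] [set b; u].
  exists (fun_edges [set: T] f) => //.
  by rewrite subUset sub1set -e0 xfF.
set F := fun_edges _ f in mF sF tF minF AF xfF *.
have buF : [set b; u] \notin F.
  (* If this edge were in [F], [b] would be the parent of [u], and the climb would enter [S] at its
     first step through this very edge, against [ne]. *)
  apply/negP => /(fun_edgesP pf)[[_ [] /eqP//]|[_ [ub bfu]]].
  have k0 : (k < 1)%N by apply: (kmin 1%N); rewrite /= -bfu.
  case: k k0 @x {kS kmin xS fxS xb xfF} ne => //= _; by rewrite -bfu setUC eqxx.
pose G := [set b; u] |: F :\ [set x; f x].
have cardG : #|G| = #|T|.-1.
  rewrite -(card_spanning_tree tF) (cardsD1 [set x; f x] F) xfF /G.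
  by rewrite cardsU1 !inE (negPf buF) andbF.
have sG : G \subset edges P.
  by rewrite subUset sub1set buE; apply: subset_trans (subD1set _ _) sF.
have memG z : z != b -> [set z; f z] != [set x; f x] -> [set z; f z] \in G.
  by move=> zb zx; rewrite !inE zx (mem_fun_edges pf) ?orbT.
have fxb : connect (adj G) (f x) b.
  apply: (rank_connect (f := f) (d := d)) => [z|z zb dz]; first exact: dP.
  apply: memG => //; apply: contraTneq dz => e.
  by rewrite (parent_fun_inj pf _ _ zb xb e) // -ltnNge dP.
have bu : connect (adj G) b u by apply: connect1; rewrite /adj !inE eqxx.
have ux : connect (adj G) u x.
  suff H j : (j <= k)%N -> connect (adj G) u (iter j f u) by apply: H.
  elim: j => //= j IH jk; apply: connect_trans (IH (ltnW jk)) (connect1 _).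
  have zS i : (i <= k)%N -> iter i f u \notin S.
    by move=> ik; apply/negP => /kmin; rewrite ltnNge ik.
  apply: memG; first by apply: contraNneq (zS j (ltnW jk)) => ->.
  (* The deleted edge has the end [f x] in [S], while both ends of the present edge lie outside
     [S]. *)
  apply/eqP => e; have : f x \in [set iter j f u; f (iter j f u)] by rewrite e set22.
  rewrite !inE => /orP[]/eqP E; rewrite E in fxS.
    by have := zS j (ltnW jk); rewrite fxS.
  by have := zS j.+1 jk; rewrite /= fxS.
(* The ends of the deleted edge stay connected through [b] and [u], so [G] is connected. *)
have fxx : connect (adj G) (f x) x := connect_trans fxb (connect_trans bu ux).
have cG i j : connect (adj G) i j.
  case: tF => _ /(_ i j) + _; apply: connect_sub => {i j} i j ijF.
  have [e|nij] := eqVneq [set i; j] [set x; f x]; last first.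
    by apply: connect1; rewrite /adj !inE nij (ijF : [set i; j] \in F) orbT.
  by case: (set2_eq e) => -[-> ->] //; rewrite connect_adj_sym.
exists G; last first.
  rewrite subUset sub1set setU11 /=; apply: subset_trans (subsetUr _ _).
  rewrite subsetD1 AF; apply: contraNN xS => /AS; rewrite subUset sub1set.
  by case/andP.
split=> //; first exact: spanning_tree_card b cG cardG.
move=> H sH tH; apply: le_trans (minF H sH tH).
rewrite /tree_weight [leRHS](big_setD1 _ xfF) [leLHS]big_setU1 /=; last first.
  by rewrite !inE (negPf buF) andbF.
rewrite lerD2r [[set x; _]]setUC; apply: bu_min => //.
by rewrite setUC; apply: (subsetP sF).
Qed.

End Weights.

(** * Programs and their cost *)

Section Logic.
Variable R : realType.
Implicit Types (s : state R) (c d : prog) (Q : state R -> Prop).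

Definition runs (n : nat) c s Q : Prop :=
  exists m s', [/\ exec c s m s', (m <= n)%N & Q s'].

Definition writes_ireg (x : nat) (c : instr) : bool :=
  match c with
  | IConst y _ | IMove y _ | ISucc y _ | ILoad y _ _ _ => x == y
  | _ => false
  end.

Definition writes_icell (k : nat) (c : instr) : bool :=
  if c is IStore k' _ _ _ then k == k' else false.

Definition writes_wreg (u : nat) (c : instr) : bool :=
  match c with
  | WMove v _ | WAdd v _ _ | WSub v _ _ | WLoad v _ _ _ => u == v
  | _ => false
  end.

Definition writes_wcell (k : nat) (c : instr) : bool :=
  if c is WStore k' _ _ _ then k == k' else false.

Fixpoint has_instr (a : pred instr) c : bool :=
  match c with
  | Instr i => a i
  | Seq c d | If _ c d => has_instr a c || has_instr a d
  | While _ c => has_instr a c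
  end.

(** The conditions are syntactic and decided by computation, so the specification of each program
    piece has to mention only the cells it changes. *)
Record frame c s s' : Prop := Frame {
  frame_ireg x : ~~ has_instr (writes_ireg x) c -> ireg s' x = ireg s x;
  frame_icell k i j : ~~ has_instr (writes_icell k) c ->
    icell s' (k, i, j) = icell s (k, i, j);
  frame_wreg u : ~~ has_instr (writes_wreg u) c -> wreg s' u = wreg s u;
  frame_wcell k i j : ~~ has_instr (writes_wcell k) c ->
    wcell s' (k, i, j) = wcell s (k, i, j) }.

Lemma frame_refl c s : frame c s s. Proof. by []. Qed.

Lemma frame_trans c s1 s2 s3 : frame c s1 s2 -> frame c s2 s3 -> frame c s1 s3.
Proof.
case=> a1 a2 a3 a4 [b1 b2 b3 b4]; split=> *.
- by rewrite b1 // a1.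
- by rewrite b2 // a2.
- by rewrite b3 // a3.
- by rewrite b4 // a4.
Qed.

Lemma frame_sub c d s s' : (forall a, has_instr a c -> has_instr a d) ->
  frame c s s' -> frame d s s'.
Proof.
move=> sub [a1 a2 a3 a4].
by split=> *; [apply: a1|apply: a2|apply: a3|apply: a4]; apply: contraNN (sub _) _.
Qed.

Lemma updE (K : eqType) (V : Type) (f : K -> V) k v k' :
  upd f k v k' = if k' == k then v else f k'.
Proof. by []. Qed.

Lemma frame_instr (a : instr) s : frame (Instr a) s (step a s).
Proof.
by split; case: a => //= *; rewrite updE ?xpair_eqE (negPf (_ : is_true (~~ (_ == _)))).
Qed.

Lemma exec_frame c s n s' : exec c s n s' -> frame c s s'.
Proof.
elim=> [a s1|c1 d s1 s2 s3 m k _ f1 _ f2|t c1 d s1 s2 k _ f|*|t c1 s1 s2 s3 m k _ _ f1 _ f2].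
- exact: frame_instr.
- by apply: frame_trans (frame_sub _ f1) (frame_sub _ f2) => a /= ->; rewrite ?orbT.
- by move: f; case: ifP => _; apply: frame_sub => a /= ->; rewrite ?orbT.
- exact: frame_refl.
- exact: frame_trans (frame_sub _ f1) f2.
Qed.

Lemma runs_mono m n c s (Q1 Q2 : state R -> Prop) : (m <= n)%N ->
  runs m c s Q1 -> (forall s', frame c s s' -> Q1 s' -> Q2 s') -> runs n c s Q2.
Proof.
move=> mn [k [s' [e km q]]] H; exists k, s'; split=> //; first exact: leq_trans mn.
exact: H (exec_frame e) q.
Qed.

Lemma runs_seq m n c d s (Q1 Q2 : state R -> Prop) :
  runs m c s Q1 -> (forall s', frame c s s' -> Q1 s' -> runs n d s' Q2) ->
  runs (m + n) (Seq c d) s Q2.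
Proof.
move=> [k [s' [e km q]]] H; have [l [s2 [e2 ln q2]]] := H s' (exec_frame e) q.
by exists (k + l)%N, s2; split=> //; [apply: ExecSeq e e2 | apply: leq_add].
Qed.

(* [wp] and [cost] are meaningful only on programs without [While]. *)
Fixpoint wp c s Q : Prop :=
  match c with
  | Instr a => Q (step a s)
  | Seq c d => wp c s (fun s' => wp d s' Q)
  | If t c d => if holds t s then wp c s Q else wp d s Q
  | While _ _ => False
  end.

Fixpoint cost c : nat :=
  match c with
  | Instr _ => 1
  | Seq c d => cost c + cost d
  | If _ c d => (cost c + cost d).+1
  | While _ _ => 0
  end.

Lemma runs_wp c s Q : wp c s Q -> runs (cost c) c s Q.
Proof.
elim: c s Q => [a|c IHc d IHd|t c IHc d IHd|//] s Q /=.
- by exists 1%N, (step a s); split=> //; apply: ExecInstr.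
- by move/IHc/runs_seq; apply=> s' _; apply: IHd.
- case: ifP => ts => [/IHc|/IHd] [n [s' [e ln q]]]; exists n.+1, s';
    split=> //; rewrite ?ltnS; try (by apply: ExecIf; rewrite ts); apply: leq_trans ln _.
    exact: leq_addr.
  exact: leq_addl.
Qed.

Lemma runs_if n t c d s Q :
  (holds t s -> runs n c s Q) -> (~~ holds t s -> runs n d s Q) ->
  runs n.+1 (If t c d) s Q.
Proof.
by case: (boolP (holds t s)) => ts => [/(_ isT)+ _|_ /(_ isT)] => -[m [s' [e mn q]]];
  exists m.+1, s'; split=> //; apply: ExecIf; rewrite ?ts // ifN.
Qed.

Definition for_loop (i : nat) c : prog :=
  Seq (Instr (IConst i 0)) (While (ILt i 0) (Seq c (Instr (ISucc i i)))).

Variable T : finType.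

(** Each round pays for the body, one test and one increment; the last two operations are the reset
    of the counter and the failing test. The counter is presented as the number of a vertex [v],
    ready for use as an array index. *)
Lemma runs_for i c B (I : nat -> state R -> Prop) s :
  ~~ has_instr (writes_ireg 0) (for_loop i c) -> ~~ has_instr (writes_ireg i) c ->
  ireg s 0%N = #|T| -> I 0%N (set_ireg s i 0) ->
  (forall (v : T) s1, frame (for_loop i c) s s1 -> ireg s1 i = enum_rank v ->
     I (enum_rank v) s1 ->
     runs B c s1 (fun s2 => I (enum_rank v).+1 (set_ireg s2 i (enum_rank v).+1))) ->
  runs (#|T| * B.+2 + 2) (for_loop i c) s (I #|T|).
Proof.
move=> w0 wi sN I0 Istep; rewrite addnC.
set w := While (ILt i 0) (Seq c (Instr (ISucc i i))).
suff H m k s1 : (k + m)%N = #|T| -> frame (for_loop i c) s s1 -> ireg s1 i = k ->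
    I k s1 -> runs (m * B.+2 + 1) w s1 (I #|T|).
  rewrite (_ : 2 + _ = 1 + (#|T| * B.+2 + 1))%N; last by rewrite addn1 addnS.
  apply: (@runs_seq _ _ _ _ _ (fun s' => s' = set_ireg s i 0)).
    by apply: runs_wp.
  move=> s' fr e; apply: (H #|T| 0%N) => //.
  - by rewrite /for_loop; apply: frame_sub fr => a /= ->.
  - by rewrite e /= updE eqxx.
  - by rewrite e.
elim: m k s1 => [|m IH] k s1 kN fr s1i Ik.
  rewrite addn0 in kN; rewrite kN in s1i Ik; exists 1%N, s1; split=> //.
  by apply: ExecWhileStop; rewrite /= s1i (frame_ireg fr) // sN ltnn.
have kT : (k < #|T|)%N by rewrite -kN addnS ltnS leq_addr.
pose v := enum_val (Ordinal kT); have vk : enum_rank v = k :> nat by rewrite enum_valK.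
have [n [s2 [e nB q]]] := Istep v s1 fr (etrans s1i (esym vk)) (eq_ind_r (fun x => I x s1) Ik vk).
have s2i : ireg s2 i = k by rewrite (frame_ireg (exec_frame e)).
have := ExecSeq e (ExecInstr (ISucc i i) s2); rewrite /= s2i => e2.
have fr2 : frame (for_loop i c) s s2.
  apply: frame_trans fr (frame_sub _ (exec_frame e)) => a /= ->; by rewrite orbT.
have [l [s3 [e3 lm q3]]] : runs (m * B.+2 + 1) w (set_ireg s2 i k.+1) (I #|T|).
  apply: (IH k.+1); rewrite ?addSnnS //.
  - apply: frame_trans fr (frame_sub _ (exec_frame e2)) => a /= ->; by rewrite orbT.
  - by rewrite /= updE eqxx.
  - by rewrite -vk.
exists (n + 1 + l).+1, s3; split=> //.
  apply: ExecWhileStep e2 _; first by rewrite /= s1i (frame_ireg fr) // sN.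
  exact: e3.
by rewrite mulSn addn1 -addnA !addSn !ltnS leq_add.
Qed.

End Logic.

(** * Prim's algorithm *)

Section Prim.
Variables (R : realType) (T : finType) (P : potential_graph R T).
Implicit Types (S : {set T}) (A F : {set {set T}}) (g : T -> T -> T) (q r u b v x y : T).
Local Notation w i j := (weight P [set i; j]).
Local Notation w0 i := (weight P [set i]).

(* g r is the parent function of the tree A on S when it is rooted at r. *)
Record prim_tree S A g : Prop := PrimTree {
  prim_parent : {in S, forall r, parent_fun S r (g r)};
  prim_edges : {in S, forall r, fun_edges S (g r) = A};
  prim_sub : {in A, forall e : {set T}, e \subset S};
  prim_min : exists2 F, min_spanning_tree P F & A \subset F }.

Definition extend g b u r x : T :=
  if r == u then if (x == b) || (x == u) then u else g b x
  else if x == u then b else g r x.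

Definition lightest_leaving S b u : Prop :=
  [/\ b \in S, u \notin S, [set b; u] \in edges P
    & forall x y, x \in S -> y \notin S -> [set x; y] \in edges P -> w b u <= w x y].

Lemma prim_tree0 g : prim_tree set0 set0 g.
Proof.
split=> [r|r|e|]; rewrite ?inE //.
by have [F mF] := min_spanning_tree_ex P; exists F; rewrite ?sub0set.
Qed.

(** The first vertex is inserted by the same instructions as all others, with itself in the role of
    its neighbour; hence [extend g u u]. *)
Lemma prim_tree1 g u : prim_tree [set u] set0 (extend g u u).
Proof.
have pf : parent_fun [set u] u (extend g u u u).
  have uu : extend g u u u u = u by rewrite /extend !eqxx.
  split; rewrite ?set11 //; first by move=> x /set1P->; rewrite uu set11.
  by exists (fun=> 0%N) => x /set1P->; rewrite eqxx.
split=> [r /set1P-> //|r /set1P->|e|]; rewrite ?inE //.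
  by apply/eqP; rewrite -cards_eq0 (card_fun_edges pf) cards1.
by have [F mF] := min_spanning_tree_ex P; exists F; rewrite ?sub0set.
Qed.

Lemma prim_tree_extend S A g b u : prim_tree S A g -> lightest_leaving S b u ->
  prim_tree (u |: S) ([set b; u] |: A) (extend g b u).
Proof.
move=> [gP gA AS [F mF AF]] [bS uS buE bu_min].
have ext r : r \in u |: S ->
    parent_fun (u |: S) r (extend g b u r) /\
    fun_edges (u |: S) (extend g b u r) = [set b; u] |: A.
  rewrite /extend !inE; case: eqVneq => /= [-> _|ru rS].
    by split; [apply: parent_fun_reroot (gP b bS) uS
              | rewrite (fun_edges_reroot (gP b bS)) // gA].
  split; first exact: parent_fun_leaf (gP r rS) uS bS.
  by rewrite (fun_edges_leaf (gP r rS)) // gA.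
split=> [r /ext[]//|r /ext[]//|e|].
  rewrite !inE => /orP[/eqP->|/AS eS]; last by rewrite (subset_trans eS) ?subsetUr.
  by rewrite subUset !sub1set !inE eqxx bS orbT.
exact: min_spanning_tree_exchange mF AF AS bS uS buE bu_min.
Qed.

Lemma prim_tree_min A g : prim_tree [set: T] A g -> min_spanning_tree P A.
Proof.
have /card_gt0P[q _] := vertices_neq0 P.
case=> gP gA _ [F mF AF]; suff -> : A = F by [].
apply/eqP; rewrite eqEcard AF -(gA q) // (card_fun_edges (gP q _)) // cardsT.
by case: mF => _ tF _; rewrite (card_spanning_tree tF) leqnn.
Qed.

(* b is the stored endpoint of a lightest edge from S to v; b = v encodes that no
   edge joins S to v. *)
Definition nearest S v b : Prop :=
  if b == v then forall x, x \in S -> [set x; v] \notin edges P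
  else [/\ b \in S, [set b; v] \in edges P
         & forall x, x \in S -> [set x; v] \in edges P -> w b v <= w x v].

Lemma nearest_extend S u v b : v != u ->  nearest S v b ->
  nearest (u |: S) v
    (if ([set u; v] \in edges P) && ((b == v) || (w u v < w b v)) then u else b).
Proof.
rewrite eq_sym /nearest => uv.
case: (boolP ([set u; v] \in edges P)) => /= uvE; last first.
  case: (eqVneq b v) => [_ H|bv [bS bvE bmin]].
    by move=> x /setU1P[->|/H].
  split; rewrite ?inE ?bS ?orbT // => x /setU1P[->|xS]; last exact: bmin.
  by rewrite (negPf uvE).
case: (eqVneq b v) => /= [_ H|bv [bS bvE bmin]].
  rewrite (negPf uv); split; rewrite ?setU11 // => x /setU1P[->//|/H/negPf->//].
case: ltP => [ub|ub].
  rewrite (negPf uv); split; rewrite ?setU11 // => x /setU1P[->//|xS xE].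
  exact: le_trans (ltW ub) (bmin x xS xE).
rewrite (negPf bv); split; rewrite ?inE ?bS ?orbT // => x /setU1P[->//|].
exact: bmin.
Qed.

(** A lightest edge leaving [S] is found by minimizing over its outer end [v] the lightest edge from
    [S] to [v]. *)
Lemma nearest_lightest S (c : T -> T) u : u \notin S ->
  (forall v, v \notin S -> nearest S v (c v)) -> c u != u ->
  (forall v, v \notin S -> c v != v -> w (c u) u <= w (c v) v) ->
  lightest_leaving S (c u) u.
Proof.
move=> uS cP cu umin; have := cP u uS; rewrite /nearest (negPf cu) => -[cS cE _].
split=> // x y xS yS xyE; have := cP y yS; rewrite /nearest.
case: eqVneq => [_ /(_ x xS)|cy [_ _ /(_ x xS xyE)]]; first by rewrite xyE.
by apply: le_trans; apply: umin.
Qed.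

Lemma nearest_cross S (c : T -> T) x y : x \in S -> y \notin S ->
  (forall v, v \notin S -> nearest S v (c v)) -> exists2 v, v \notin S & c v != v.
Proof.
move=> xS yS cP; have [a [v [aS vS av]]] := connected_cross (edges_connected P x y) xS yS.
exists v => //; have := cP v vS; rewrite /nearest; case: eqVneq => // _ /(_ a aS).
by rewrite (av : [set a; v] \in edges P).
Qed.

End Prim.

(* The program *)
Declare Scope prog_scope.
Delimit Scope prog_scope with P.
Coercion Instr : instr >-> prog.
Infix ";;" := Seq (at level 95, right associativity) : prog_scope.

(* Index registers: 0 = number of vertices, 1 = zero, 2 = current vertex u,
   3 = neighbour of u in the tree, 4 = outer counter, 5 = inner counter,
   7 = candidate for the next vertex (the number of vertices if there is none).
   Weight registers: 0 = accumulated weight, 3 = weight of the candidate edge.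
   Index arrays: row 0 of 3 = membership in the tree, row 0 of 4 = nearest
   tree vertex. *)

Definition setup_prog : prog := (
  IConst 1 0 ;; IConst 2 0 ;; WSub 0 0 0 ;; WLoad 1 0 1 1 ;; WSub 0 0 1)%P.

(** Storing [v] as its own nearest vertex encodes that no edge is known, and also makes the first
    inserted vertex its own neighbour. *)
Definition clear_prog : prog :=
  for_loop 5 (IStore 3 1 5 1 ;; IStore 4 1 5 5)%P.

Definition insert_prog : prog := (
  ILoad 3 4 1 2 ;; IConst 6 1 ;; IStore 3 1 2 6 ;;
  WLoad 1 0 3 2 ;; WAdd 0 0 1 ;; WLoad 1 0 2 2 ;; WSub 0 0 1 ;;
  IMove 7 0)%P.

(** The loop also writes entries for vertices outside the tree. They are garbage, overwritten when
    the vertex of that row or column joins. The last two stores repair the entries of [b] and [u] in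
    the new row. *)
Definition link_prog : prog := (
  for_loop 5 (IStore 1 5 2 3 ;; ILoad 6 1 3 5 ;; IStore 1 2 5 6) ;;
  IStore 1 2 3 2 ;; IStore 1 2 2 2)%P.

(** [IMove 6 6] serves as a skip. A loaded weight may belong to a non-edge and be arbitrary; the
    index tests ensure that weights are compared only when both edges exist. *)
Definition near_prog : prog := (
  ILoad 8 0 2 5 ;; ILoad 6 4 1 5 ;; WLoad 1 0 2 5 ;; WLoad 2 0 6 5 ;;
  If (IEq 8 1) (IMove 6 6)
    (If (IEq 6 5) (IMove 6 2) (If (WLt 1 2) (IMove 6 2) (IMove 6 6))) ;;
  IStore 4 1 5 6)%P.

Definition pick_prog : prog := (
  WLoad 2 0 6 5 ;;
  If (IEq 6 5) (IMove 6 6)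
    (If (IEq 7 0) (IMove 7 5 ;; WMove 3 2)
      (If (WLt 2 3) (IMove 7 5 ;; WMove 3 2) (IMove 6 6))))%P.

Definition scan_prog : prog := (
  for_loop 5 (
    ILoad 6 3 1 5 ;;
    If (IEq 6 1) (near_prog ;; pick_prog) (IMove 6 6)) ;;
  IMove 2 7)%P.

Definition weights_prog : prog := for_loop 5 (
  WLoad 1 0 5 5 ;; WAdd 2 0 1 ;; WStore 1 5 1 2 ;;
  If (WLt 1 3) (WMove 3 1 ;; IMove 2 5) (IMove 6 6))%P.

Definition copy_prog : prog := for_loop 5 (ILoad 6 1 2 5 ;; IStore 2 1 5 6)%P.

Definition step_prog : prog := (insert_prog ;; link_prog ;; scan_prog)%P.

Definition prim_prog : prog := (
  (setup_prog ;; clear_prog) ;;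
  for_loop 4 step_prog ;;
  (IConst 2 0 ;; WLoad 3 0 1 1) ;; weights_prog ;; copy_prog)%P.

(** * Correctness and operation count of the program *)

Section Correctness.
Variables (R : realType) (T : finType) (P : potential_graph R T).
Implicit Types (s : state R) (S : {set T}) (A F : {set {set T}}) (q r u b v x y : T).
Implicit Types (g : T -> T -> T) (c : T -> T).
Local Notation w i j := (weight P [set i; j]).
Local Notation w0 i := (weight P [set i]).
Local Notation rk x := (nat_of_ord (enum_rank x)).

Variable u0 : T.
Hypothesis u0E : rk u0 = 0%N.

Lemma rk_eq x y : (rk x == rk y) = (x == y).
Proof. by rewrite (inj_eq val_inj) (inj_eq enum_rank_inj). Qed.

Lemma rk_lt x : (rk x < #|T|)%N. Proof. exact: ltn_ord. Qed.

Lemma input_state_frame p s s' : frame p s s' ->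
  ~~ [|| has_instr (writes_ireg 0) p, has_instr (writes_icell 0) p
       | has_instr (writes_wcell 0) p] ->
  input_state P s -> input_state P s'.
Proof.
move=> fr; rewrite !negb_or => /and3P[h1 h2 h3] [n a e].
split=> [|i j|i j ij]; first by rewrite (frame_ireg fr).
- by rewrite (frame_icell fr).
- by rewrite (frame_wcell fr) // e.
Qed.

Lemma input_edge s x y : input_state P s -> [set x; y] \in edges P ->
  wcell s (0%N, rk x, rk y) = w x y.
Proof. by case=> _ _; apply. Qed.

Lemma input_loop s x : input_state P s -> wcell s (0%N, rk x, rk x) = w0 x.
Proof. by move=> i; rewrite (input_edge i) setUid ?edges_loop. Qed.


Lemma insert_runs s u b : input_state P s -> ireg s 1%N = 0%N -> ireg s 2%N = rk u ->
  icell s (4%N, 0%N, rk u) = rk b -> [set b; u] \in edges P ->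
  runs 8 insert_prog s (fun s' =>
    [/\ ireg s' 3%N = rk b, ireg s' 7%N = #|T|, wreg s' 0%N = wreg s 0%N + w b u - w0 u
      & forall v, icell s' (3%N, 0%N, rk v) =
                  if v == u then 1%N else icell s (3%N, 0%N, rk v)]).
Proof.
move=> inp z su sb bu; apply: runs_wp => /=; rewrite !updE /= z su sb.
rewrite (input_edge inp bu) (input_loop _ inp); split=> //; first by case: inp.
by move=> v; rewrite updE !xpair_eqE eqxx /= rk_eq.
Qed.

(** The machine has no weight constants, so zero is produced by subtracting a register from itself.
    The accumulator starts at minus the loop weight of [u0] because inserting [u0] as its own
    neighbour adds [w0 u0 - w0 u0]. *)
Lemma setup_runs s : input_state P s ->
  runs 5 setup_prog s (fun s' =>
    [/\ ireg s' 1%N = 0%N, ireg s' 2%N = 0%N & wreg s' 0%N = - w0 u0]).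
Proof.
move=> inp; apply: runs_wp => /=; rewrite !updE /=; split=> //.
by rewrite subrr sub0r -[in (0%N, _, _)]u0E -(input_loop u0 inp) u0E.
Qed.

Lemma clear_runs s : input_state P s -> ireg s 1%N = 0%N ->
  runs (#|T| * 4 + 2) clear_prog s (fun s' =>
    [/\ forall v, icell s' (3%N, 0%N, rk v) = 0%N
      & forall v, icell s' (4%N, 0%N, rk v) = rk v]).
Proof.
move=> inp z; pose I k s1 :=
  [/\ forall v, (rk v < k)%N -> icell s1 (3%N, 0%N, rk v) = 0%N
    & forall v, (rk v < k)%N -> icell s1 (4%N, 0%N, rk v) = rk v].
apply: (@runs_mono _ (#|T| * 4 + 2) _ _ _ (I #|T|)) => //; last first.
  by move=> s' _ [a b]; split=> v; [apply: a|apply: b]; apply: rk_lt.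
apply: (@runs_for _ _ _ _ 2 I) => //; first by case: inp.
move=> v s1 fr s5 [a b]; apply: runs_wp; split=> x.
  rewrite /= !updE /= (frame_ireg fr) // z s5 !xpair_eqE !eqxx /= rk_eq ltnS leq_eqVlt rk_eq.
  by case: eqVneq => [->|_] //= /a.
rewrite /= !updE /= (frame_ireg fr) // z s5 !xpair_eqE !eqxx /= rk_eq ltnS leq_eqVlt rk_eq.
by case: eqVneq => [->|_] //= /b.
Qed.

Lemma link_runs s S g b u : ireg s 0%N = #|T| -> ireg s 2%N = rk u ->
  ireg s 3%N = rk b -> u \notin S -> b \in S \/ S = set0 /\ b = u ->
  {in S &, forall r x, icell s (1%N, rk r, rk x) = rk (g r x)} ->
  runs (#|T| * 5 + 4) link_prog s (fun s' =>
    {in u |: S &, forall r x, icell s' (1%N, rk r, rk x) = rk (extend g b u r x)}).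
Proof.
move=> sN s2 s3 uS bS rows.
have neu x : x \in S -> (x == u) = false.
  by move=> xS; apply/negP => /eqP xu; rewrite -xu xS in uS.
pose I k s1 :=
  [/\ {in S &, forall r x, icell s1 (1%N, rk r, rk x) = rk (g r x)},
       forall x, x \in S -> (rk x < k)%N -> icell s1 (1%N, rk x, rk u) = rk b
     & forall x, x \in S -> (rk x < k)%N -> icell s1 (1%N, rk u, rk x) = rk (g b x)].
rewrite (_ : _ + 4 = #|T| * 5 + 2 + 2)%N; last by rewrite -addnA.
apply: (@runs_seq _ _ _ _ _ _ (I #|T|)).
  apply: (@runs_for _ _ _ _ 3 I) => // v s1 fr s5 [rows1 col row].
  have [f2 f3] : ireg s1 2%N = rk u /\ ireg s1 3%N = rk b by rewrite !(frame_ireg fr).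
  apply: runs_wp; split=> [r x rS xS|x xS|x xS];
    rewrite /= !updE /= ?updE /= f2 f3 s5 !xpair_eqE /= !rk_eq.
  - by rewrite (neu r) // (neu x) // andbF /=; apply: rows1.
  - rewrite (neu x) //= eqxx /= andbT ltnS leq_eqVlt rk_eq.
    by case: eqVneq => //= _; apply: col.
  (* The load from row [b] comes after the store into column [u], but reads another column since [x]
     differs from [u]. *)
  - rewrite eqxx /= ltnS leq_eqVlt rk_eq (neu x) // andbF.
    case: eqVneq => [<- _|_] //=; last exact: row.
    rewrite (neu x) // andbF; apply: rows1 => //.
    by case: bS => // -[S0 _]; rewrite S0 inE in xS.
move=> s1 fr [rows1 col row]; apply: runs_wp => /=.
rewrite !(frame_ireg fr) // s2 s3 => r x; rewrite !inE !updE !xpair_eqE /= !rk_eq /extend.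
have [->|ru] /= := eqVneq r u.
  have [->|xu] /= := eqVneq x u; first by rewrite orbT.
  have [->|xb] //= := eqVneq x b => _ xS; exact: row xS (rk_lt x).
move=> rS; have [->|xu] /= := eqVneq x u; first by move=> _; apply: col rS (rk_lt r).
by move=> xS; apply: rows1.
Qed.

Definition improve u v b : T :=
  if ([set u; v] \in edges P) && ((b == v) || (w u v < w b v)) then u else b.

Lemma near_runs s u v b : input_state P s -> ireg s 1%N = 0%N -> ireg s 2%N = rk u ->
  ireg s 5%N = rk v -> icell s (4%N, 0%N, rk v) = rk b ->
  (b != v -> [set b; v] \in edges P) ->
  runs (cost near_prog) near_prog s (fun s' => ireg s' 6%N = rk (improve u v b) /\
    forall x, icell s' (4%N, 0%N, rk x) =
              if x == v then rk (improve u v b) else icell s (4%N, 0%N, rk x)).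
Proof.
move=> inp z su sv sb bE; apply: runs_wp.
rewrite /= /upd /= z su sv sb; case: (inp) => _ -> wE.
have key d x : (if (4%N, 0%N, rk x) == (4%N, 0%N, rk v) then rk d
    else icell s (4%N, 0%N, rk x)) = if x == v then rk d else icell s (4%N, 0%N, rk x).
  by rewrite !xpair_eqE !eqxx /= rk_eq.
rewrite rk_eq /improve; case: (boolP ([set u; v] \in edges P)) => [uvE|_] /=; last by split.
case: eqVneq => [_|bv]; first by split.
by rewrite !wE ?bE //=; case: ltP; split.
Qed.

Lemma pick_runs s v d : input_state P s -> ireg s 5%N = rk v -> ireg s 6%N = rk d ->
  (d != v -> [set d; v] \in edges P) ->
  runs (cost pick_prog) pick_prog s (fun s' =>
    if (d != v) && ((ireg s 7%N == #|T|) || (w d v < wreg s 3%N))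
    then ireg s' 7%N = rk v /\ wreg s' 3%N = w d v
    else ireg s' 7%N = ireg s 7%N /\ wreg s' 3%N = wreg s 3%N).
Proof.
move=> inp sv sd dE; apply: runs_wp; rewrite /= /upd /= sv sd rk_eq.
have -> : ireg s 0%N = #|T| by case: inp.
case: eqVneq => [_|dv] /=; first by split.
rewrite (input_edge inp) ?dE //.
by case: eqVneq => _ /=; [split | case: ltP; split].
Qed.

(* Index register 7 and weight register 3 hold the best candidate among the
   vertices numbered below k. *)
Definition picked S c k s : Prop :=
  (ireg s 7%N = #|T| /\ forall v, v \notin S -> (rk v < k)%N -> c v = v) \/
  exists y, [/\ y \notin S, c y != y, ireg s 7%N = rk y, wreg s 3%N = w (c y) y
    & forall v, v \notin S -> (rk v < k)%N -> c v != v -> w (c y) y <= w (c v) v].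

Lemma picked_skip S c v s s' : v \in S \/ c v = v ->
  ireg s' 7%N = ireg s 7%N -> wreg s' 3%N = wreg s 3%N ->
  picked S c (rk v) s -> picked S c (rk v).+1 s'.
Proof.
move=> vP e7 e3 [[s7 H]|[y [yS cy s7 s3 H]]]; [left|right; exists y];
  split; rewrite ?e7 ?e3 // => x xS; rewrite ltnS leq_eqVlt rk_eq => /orP[/eqP xv|].
- by subst x; case: vP => // vS; rewrite vS in xS.
- exact: H.
- by subst x; case: vP => [vS|->]; [rewrite vS in xS | rewrite eqxx].
- exact: H.
Qed.

Lemma picked_step S c v s s' : v \notin S ->
  (if (c v != v) && ((ireg s 7%N == #|T|) || (w (c v) v < wreg s 3%N))
   then ireg s' 7%N = rk v /\ wreg s' 3%N = w (c v) v
   else ireg s' 7%N = ireg s 7%N /\ wreg s' 3%N = wreg s 3%N) ->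
  picked S c (rk v) s -> picked S c (rk v).+1 s'.
Proof.
move=> vS; case: (eqVneq (c v) v) => [cv [e7 e3]|cv] /=.
  by apply: picked_skip => //; right.
move=> step [[s7 H]|[y [yS cy s7 s3 H]]]; move: step; rewrite s7 /=.
  rewrite eqxx => -[e7 e3]; right; exists v; split=> // x xS.
  rewrite ltnS leq_eqVlt rk_eq => /orP[/eqP->//|/(H x xS)->]; by rewrite eqxx.
rewrite s3 (ltn_eqF (rk_lt y)) /=; case: ltP => cvy [e7 e3]; right.
  exists v; split=> // x xS; rewrite ltnS leq_eqVlt rk_eq => /orP[/eqP->//|xv cx].
  exact: le_trans (ltW cvy) (H x xS xv cx).
exists y; split=> // x xS; rewrite ltnS leq_eqVlt rk_eq => /orP[/eqP->//|].
exact: H.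
Qed.

Lemma scan_runs s S c u : input_state P s -> ireg s 1%N = 0%N -> ireg s 2%N = rk u ->
  ireg s 7%N = #|T| -> u \in S ->
  (forall v, icell s (3%N, 0%N, rk v) = (v \in S)) ->
  (forall v, v \notin S -> icell s (4%N, 0%N, rk v) = rk (c v)) ->
  (forall v, v \notin S -> c v != v -> [set c v; v] \in edges P) ->
  let c' v := improve u v (c v) in
  runs (#|T| * 26 + 3) scan_prog s (fun s' =>
    (forall v, v \notin S -> icell s' (4%N, 0%N, rk v) = rk (c' v)) /\
    ((forall v, v \notin S -> c' v = v) \/
     exists y, [/\ y \notin S, c' y != y, ireg s' 2%N = rk y
       & forall v, v \notin S -> c' v != v -> w (c' y) y <= w (c' v) v])).
Proof.
move=> inp z su s7 uS inS sc cE c'.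
pose I k s1 := (forall v, v \notin S ->
    icell s1 (4%N, 0%N, rk v) = rk (if (rk v < k)%N then c' v else c v)) /\ picked S c' k s1.
rewrite (_ : _ + 3 = #|T| * 26 + 2 + 1)%N; last by rewrite -addnA.
apply: (@runs_seq _ _ _ _ _ _ (I #|T|)); last first.
  move=> s1 fr [s4 pk]; apply: runs_wp => /=.
  split=> [v vS|]; first by rewrite s4 // rk_lt.
  case: pk => [[_ H]|[y [yS cy y7 _ H]]]; [left|right; exists y].
    by move=> v vS; apply: H (rk_lt v).
  by split=> // v vS; apply: H (rk_lt v).
(* 24 is one load, one test and the 22 operations bounding [near_prog] and [pick_prog]. *)
apply: (@runs_for _ _ _ _ 24 I) => //; first by case: inp.
  by split=> [v vS|]; [rewrite ltn0 sc | left; split].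
move=> v s1 fr sv [s4 pk].
have inp1 : input_state P s1 by apply: input_state_frame fr _ inp.
have [z1 u1] : ireg s1 1%N = 0%N /\ ireg s1 2%N = rk u by rewrite !(frame_ireg fr).
have in1 : icell s1 (3%N, 0%N, rk v) = (v \in S) by rewrite (frame_icell fr) // inS.
have s41 : v \notin S -> icell s1 (4%N, 0%N, rk v) = rk (c v).
  by move=> vS; rewrite s4 // ltnn.
pose load := step (ILoad 6 3 1 5) s1.
apply: (@runs_seq _ 1 23 _ _ _ (fun s2 => s2 = load)); first exact: runs_wp.
move=> s2 _ ->; have l6 : ireg load 6%N = (v \in S) by rewrite /= z1 sv in1.
have s4P k : (rk k < (rk v).+1)%N = (k == v) || (rk k < rk v)%N.
  by rewrite ltnS leq_eqVlt rk_eq.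
apply: (@runs_if _ 22); last first.
  rewrite /= !updE /= z1 sv in1 eqb0 negbK => vS.
  apply: (@runs_mono _ 1 22 _ _ (fun s => s = step (IMove 6 6) load)) => //.
    exact: runs_wp.
  move=> s3 _ ->; split=> [x xS|]; last by apply: picked_skip pk => //; left.
  rewrite /= s4 // s4P; case: eqVneq => // xv; by rewrite xv vS in xS.
rewrite /= !updE /= z1 sv in1 eqb0 => vS.
have inpl : input_state P load by [].
have ld4 : icell load (4%N, 0%N, rk v) = rk (c v) by rewrite /= s41.
apply: (@runs_seq _ (cost near_prog) (cost pick_prog) _ _ _ _ _
  (near_runs inpl z1 u1 sv ld4 (cE v vS))) => s3 fr3 [s36 s34].
have inp3 : input_state P s3 by apply: input_state_frame fr3 _ inpl.
have s35 : ireg s3 5%N = rk v by rewrite (frame_ireg fr3).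
have c'E : c' v != v -> [set c' v; v] \in edges P.
  by rewrite /c' /improve; case: ifP => [/andP[]//|_]; apply: cE.
apply: runs_mono (pick_runs inp3 s35 s36 c'E) _ => // s' fr' pick; split=> [x xS|].
  rewrite /= (frame_icell fr') // s34 s4P; case: eqVneq => [->//|xv] /=.
  by rewrite s4.
apply: (@picked_step _ _ _ s3) => //.
case: pk => [[e7 H]|[y [yS cy e7 e3 H]]]; [left|right; exists y]; split=> //;
  by rewrite ?(frame_ireg fr3) // (frame_wreg fr3).
Qed.

(** The last term of [prim_acc] anticipates the first insertion, which leaves the accumulator
    unchanged. From then on it holds the tree weight minus the loop weights of [S], so that at the
    end adding [w0 q] gives the weight of the tree rooted at [q]. *)
Record prim_state k s S A g c : Prop := PrimState {
  prim_input : input_state P s;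
  prim_zero : ireg s 1%N = 0%N;
  prim_card : #|S| = k;
  prim_mem : forall v, icell s (3%N, 0%N, rk v) = (v \in S);
  prim_near : forall v, v \notin S -> icell s (4%N, 0%N, rk v) = rk (c v);
  prim_nearest : forall v, v \notin S -> nearest P S v (c v);
  prim_rows : {in S &, forall r x, icell s (1%N, rk r, rk x) = rk (g r x)};
  prim_ok : prim_tree P S A g;
  prim_acc : wreg s 0%N = tree_weight P A - \sum_(x in S) w0 x
                          - (if S == set0 then w0 u0 else 0);
  prim_next : S != [set: T] -> exists u, [/\ u \notin S, ireg s 2%N = rk u
    & if S == set0 then u = u0 /\ c u = u else lightest_leaving P S (c u) u] }.

Lemma tree_weight_setU1 A e : e \notin A ->
  tree_weight P (e |: A) = weight P e + tree_weight P A.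
Proof. exact: big_setU1. Qed.

Lemma step_runs k s S A g c : (k < #|T|)%N -> prim_state k s S A g c ->
  runs (#|T| * 31 + 15) step_prog s (fun s' =>
    exists S' A' g' c', prim_state k.+1 s' S' A' g' c').
Proof.
move=> kT [inp z Sk inS sc cn rows ok acc nxt].
have ST : S != [set: T] by apply: contraTneq kT => ST; rewrite -Sk ST cardsT ltnn.
have [u [uS s2 uP]] := nxt ST; set b := c u in uP.
have buE : [set b; u] \in edges P.
  by move: uP; case: ifP => _ [? e]; rewrite ?e ?setUid ?edges_loop.
have bS : b \in S \/ S = set0 /\ b = u.
  by move: uP; case: eqVneq => [S0 [_ e]|_ []]; [right|left].
rewrite (_ : _ + 15 = 8 + (#|T| * 5 + 4 + (#|T| * 26 + 3)))%N; last by lia.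
have cE v : v \notin S -> c v != v -> [set c v; v] \in edges P.
  by move=> vS cv; have := cn v vS; rewrite /nearest (negPf cv) => -[].
(* The first insertion adds a vertex but no edge, so [A'] stays empty; every later one adds the edge
   between [b] and [u]. *)
have [A' [okA' accA']] : exists A', prim_tree P (u |: S) A' (extend g b u) /\
    tree_weight P A' - \sum_(x in u |: S) w0 x =
    tree_weight P A - \sum_(x in S) w0 x - (if S == set0 then w0 u0 else 0) + w b u - w0 u.
  rewrite big_setU1 //=; move: uP ok.
  case: eqVneq => [-> [uu0 bu] [_ _ AS [F [_ [F2 _ _] _] AF]]|_ lu ok].
    have A0 : A = set0.
      apply/eqP/set0Pn => -[e eA]; have := F2 e (subsetP AF e eA).
      by have := AS e eA; rewrite subset0 => /eqP->; rewrite cards0.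
    exists set0; rewrite bu setU0 A0 setUid; split; first exact: prim_tree1.
    by rewrite big_set0 -uu0 !subr0 addr0 addrK.
  exists ([set b; u] |: A); split; first exact: prim_tree_extend.
  rewrite tree_weight_setU1.
    rewrite subr0 opprD addrA addrAC [w b u + _]addrC -!addrA; congr (_ + _).
    by rewrite addrCA.
  apply/negP => /(prim_sub ok); rewrite subUset !sub1set => /andP[_]; exact/negP.
apply: runs_seq (insert_runs inp z s2 (sc u uS) buE) _ => s1 fr1 [i3 i7 iw ic].
have inp1 : input_state P s1 by apply: input_state_frame fr1 _ inp.
have z1 : ireg s1 1%N = 0%N by rewrite (frame_ireg fr1).
have u1 : ireg s1 2%N = rk u by rewrite (frame_ireg fr1).
have rows1 : {in S &, forall r x, icell s1 (1%N, rk r, rk x) = rk (g r x)}.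
  by move=> r x rS xS; rewrite (frame_icell fr1) // rows.
apply: (runs_seq (link_runs _ u1 i3 uS bS rows1)); first by case: inp1.
move=> s' fr2 rows'.
have inp2 : input_state P s' by apply: input_state_frame fr2 _ inp1.
have in2 v : icell s' (3%N, 0%N, rk v) = (v \in u |: S).
  by rewrite (frame_icell fr2) // ic !inE inS; case: eqVneq.
have sc2 v : v \notin u |: S -> icell s' (4%N, 0%N, rk v) = rk (c v).
  rewrite in_setU1 => /norP[vu vS].
  by rewrite (frame_icell fr2) // (frame_icell fr1) // sc.
have z2 : ireg s' 1%N = 0%N by rewrite (frame_ireg fr2).
have u2 : ireg s' 2%N = rk u by rewrite (frame_ireg fr2).
have i72 : ireg s' 7%N = #|T| by rewrite (frame_ireg fr2).
have cE2 v : v \notin u |: S -> c v != v -> [set c v; v] \in edges P.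
  by rewrite in_setU1 => /norP[vu vS]; apply: cE.
pose c' v := improve u v (c v).
have nearest' v : v \notin u |: S -> nearest P (u |: S) v (c' v).
  by rewrite in_setU1 => /norP[vu vS]; apply: nearest_extend (cn v vS).
apply: runs_mono (scan_runs inp2 z2 u2 i72 (setU11 u S) in2 sc2 cE2) _ => //.
move=> s3 fr3 [sc3 next3]; exists (u |: S), A', (extend g b u), c'; split => //.
- exact: input_state_frame fr3 _ inp2.
- by rewrite (frame_ireg fr3).
- by rewrite cardsU1 uS Sk.
- by move=> v; rewrite (frame_icell fr3).
- by move=> r x rS xS; rewrite (frame_icell fr3) // rows'.
- rewrite setU_eq0 -cards_eq0 cards1 /= subr0 accA' -acc -iw.
  by rewrite (frame_wreg fr3) // (frame_wreg fr2).
- move=> S'T; have /subsetPn[y _ yS] : ~~ ([set: T] \subset u |: S).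
    by rewrite subTset.
  rewrite setU_eq0 -cards_eq0 cards1 /=.
  (* A scan without candidate would mean that no edge leaves [u |: S], against connectedness while a
     vertex [y] is missing. *)
  case: next3 => [H|[x [xS cx s32 xmin]]].
    have [v vS] := nearest_cross (setU11 u S) yS nearest'.
    by rewrite /c' H // eqxx.
  by exists x; split=> //; apply: nearest_lightest.
Qed.

Lemma prim_state0 s : input_state P s ->
  runs (#|T| * 4 + 7) (Seq setup_prog clear_prog) s (fun s' =>
    prim_state 0 s' set0 set0 (fun=> id) id).
Proof.
move=> inp; rewrite (_ : _ + 7 = 5 + (#|T| * 4 + 2))%N; last by lia.
apply: runs_seq (setup_runs inp) _ => s1 fr1 [z1 u1 w1].
have inp1 : input_state P s1 by apply: input_state_frame fr1 _ inp.
apply: runs_mono (clear_runs inp1 z1) _ => // s2 fr2 [s3 s4]; split=> //.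
- exact: input_state_frame fr2 _ inp1.
- by rewrite (frame_ireg fr2).
- exact: cards0.
- by move=> v; rewrite s3 inE.
- by move=> v _; rewrite /nearest eqxx => x; rewrite inE.
- by move=> r x; rewrite inE.
- exact: prim_tree0.
- by rewrite (frame_wreg fr2) // w1 eqxx /tree_weight !big_set0 subr0 sub0r.
- by move=> _; exists u0; rewrite eqxx in_set0 (frame_ireg fr2) // u1 u0E.
Qed.

Lemma weights_runs s : input_state P s -> ireg s 1%N = 0%N -> ireg s 2%N = rk u0 ->
  wreg s 3%N = w0 u0 ->
  runs (#|T| * 9 + 2) weights_prog s (fun s' =>
    (forall q, wcell s' (1%N, rk q, 0%N) = wreg s 0%N + w0 q) /\
    exists2 y, ireg s' 2%N = rk y & forall t, w0 y <= w0 t).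
Proof.
move=> inp z s2 s3.
pose I k s1 :=
  (forall q, (rk q < k)%N -> wcell s1 (1%N, rk q, 0%N) = wreg s 0%N + w0 q) /\
  exists y, [/\ ireg s1 2%N = rk y, wreg s1 3%N = w0 y
    & forall t, (rk t < k)%N -> w0 y <= w0 t].
apply: (@runs_mono _ (#|T| * 9 + 2) _ _ _ (I #|T|)) => //; last first.
  move=> s' _ [a [y [y2 _ ymin]]]; split=> [q|]; first exact: a (rk_lt q).
  by exists y => // t; apply: ymin (rk_lt t).
apply: (@runs_for _ _ _ _ 7 I) => //; first by case: inp.
  by split=> //; exists u0; split.
move=> v s1 fr sv [a [y [y2 y3 ymin]]].
have inp1 : input_state P s1 by apply: input_state_frame fr _ inp.
have vE : wcell s1 (0%N, rk v, rk v) = w0 v := input_loop v inp1.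
have z1 : ireg s1 1%N = 0%N by rewrite (frame_ireg fr).
have acc1 : wreg s1 0%N = wreg s 0%N by rewrite (frame_wreg fr).
have wE q : (rk q < (rk v).+1)%N ->
    (if (1%N, rk q, 0%N) == (1%N, rk v, 0%N) then wreg s 0%N + w0 v
     else wcell s1 (1%N, rk q, 0%N)) = wreg s 0%N + w0 q.
  rewrite ltnS leq_eqVlt rk_eq !xpair_eqE eqxx /= andbT rk_eq.
  by case: eqVneq => [->|_] //= /a.
apply: runs_wp; rewrite /= /upd /= sv vE y3 z1 acc1; case: ltP => vy.
  split=> //; exists v; split=> // t.
  rewrite ltnS leq_eqVlt rk_eq => /orP[/eqP->//|/ymin]; exact: le_trans (ltW vy).
split=> //; exists y; split=> // t.
by rewrite ltnS leq_eqVlt rk_eq => /orP[/eqP->//|/ymin].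
Qed.

Lemma copy_runs s y : ireg s 0%N = #|T| -> ireg s 1%N = 0%N -> ireg s 2%N = rk y ->
  runs (#|T| * 4 + 2) copy_prog s (fun s' =>
    forall x, icell s' (2%N, 0%N, rk x) = icell s (1%N, rk y, rk x)).
Proof.
move=> sN z s2.
pose I k s1 := forall x, (rk x < k)%N ->
  icell s1 (2%N, 0%N, rk x) = icell s (1%N, rk y, rk x).
apply: (@runs_mono _ (#|T| * 4 + 2) _ _ _ (I #|T|)) => //; last first.
  by move=> s' _ a x; apply: a (rk_lt x).
apply: (@runs_for _ _ _ _ 2 I) => // v s1 fr sv a.
have [z1 y1] : ireg s1 1%N = 0%N /\ ireg s1 2%N = rk y by rewrite !(frame_ireg fr).
apply: runs_wp => x; rewrite /= /upd /= sv z1 y1 !xpair_eqE /= rk_eq ltnS leq_eqVlt rk_eq.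
by case: eqVneq => [->|_] /=; [rewrite (frame_icell fr) | apply: a].
Qed.

Lemma read_tree_fun_arcs s k i f :
  (forall x, icell s (k, i, rk x) = rk (f x)) -> read_tree T s k i = fun_arcs f.
Proof.
by move=> sf; apply/setP => -[x y]; rewrite !inE sf rk_eq.
Qed.

Lemma prim_prog_runs s : input_state P s ->
  runs (100 * #|T| ^ 2) prim_prog s (output_state P).
Proof.
move=> inp; have N0 := vertices_neq0 P.
pose n := #|T|.
(* The sum is 31n^2 + 34n + 15, hence at most 80n^2 for positive n. *)
pose total := (n * 4 + 7 + (n * (n * 31 + 15).+2 + 2 + (2 + (n * 9 + 2 + (n * 4 + 2)))))%N.
apply: (@runs_mono _ total _ _ _ (output_state P)) => //.
  by rewrite /total -/n; have : (0 < n)%N by []; nia.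
apply: runs_seq (prim_state0 inp) _ => s0 _ st0.
pose I k s1 := exists S A g c, prim_state k s1 S A g c.
apply: (@runs_seq _ _ _ _ _ _ (I n)).
  apply: (@runs_for _ _ _ _ _ I) => //; first by case: (prim_input st0).
    by exists set0, set0, (fun=> id), id; case: st0; split.
  move=> v s1 _ _ [S [A [g [c st]]]].
  apply: runs_mono (step_runs (rk_lt v) st) _ => // s2 _ [S' [A' [g' [c' st']]]].
  by exists S', A', g', c'; case: st'; split.
move=> s1 _ [S [A [g [c [inp1 z1 Sn _ _ _ rows ok acc _]]]]].
have ST : S = [set: T] by apply/eqP; rewrite eqEcard subsetT cardsT Sn leqnn.
subst S; have minA := prim_tree_min ok; have [_ tA _] := minA.
apply: (@runs_seq _ 2 _ _ _ _ (fun s' => ireg s' 2%N = rk u0 /\ wreg s' 3%N = w0 u0)).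
  apply: runs_wp; rewrite /= /upd /= z1; split=> //.
  by rewrite -(input_loop u0 inp1) u0E.
move=> s2 fr2 [u2 w2].
have inp2 : input_state P s2 by apply: input_state_frame fr2 _ inp1.
have z2 : ireg s2 1%N = 0%N by rewrite (frame_ireg fr2).
apply: runs_seq (weights_runs inp2 z2 u2 w2) _ => s3 fr3 [wE [y y3 ymin]].
have inp3 : input_state P s3 by apply: input_state_frame fr3 _ inp2.
have z3 : ireg s3 1%N = 0%N by rewrite (frame_ireg fr3).
have n3 : ireg s3 0%N = #|T| by case: inp3.
apply: runs_mono (copy_runs n3 z3 y3) _ => // s4 fr4 copyE.
have rowE3 q x : icell s3 (1%N, rk q, rk x) = rk (g q x).
  by rewrite (frame_icell fr3) // (frame_icell fr2) // rows.
have arcsE q : assign_root A q = fun_arcs (g q).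
  by rewrite -(prim_edges ok (in_setT q)) assign_root_parent_fun //; apply: (prim_parent ok).
have treeE q : read_tree T s4 1 (rk q) = assign_root A q.
  by rewrite arcsE; apply: read_tree_fun_arcs => x; rewrite (frame_icell fr4).
have tree2E : read_tree T s4 2 0 = assign_root A y.
  by rewrite arcsE; apply: read_tree_fun_arcs => x; rewrite copyE.
have minq q := min_rooted_tree_assign_root q minA.
exists A => //; split=> [q|]; last first.
  rewrite tree2E; split; first exact: min_tree_assign_root.
  by exists y.
rewrite treeE; split=> //; have [rq mq] := minq q.
suff <- : arc_weight P (assign_root A q) = wcell s4 (1%N, rk q, 0%N).
  by split=> //; exists (assign_root A q).
rewrite arc_weight_assign_root // (frame_wcell fr4) // wE; congr (_ + _).
rewrite (frame_wreg fr2) // acc ifN; last by apply/set0Pn; exists u0.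
by rewrite subr0; congr (_ - _); apply: eq_bigl => x; rewrite inE.
Qed.

End Correctness.

Theorem mainTheorem2 (R : realType) :
  (exists (c : prog) (C : nat),
     forall (T : finType) (P : potential_graph R T) (s : state R),
       input_state P s ->
       exists (n : nat) (s' : state R),
         [/\ exec c s n s', (n <= C * #|T| ^ 2)%N & output_state P s']) /\
  (forall (T : finType) (P : potential_graph R T) (F : {set {set T}}),
     min_spanning_tree P F ->
     (forall q : T, min_rooted_tree P q (assign_root F q)) /\
     (forall y : T, (forall t : T, weight P [set y] <= weight P [set t]) ->
        min_tree P (assign_root F y))).
Proof.
split=> [|T P F minF]; last first.
  by split=> [q|y ymin]; [apply: min_rooted_tree_assign_root | apply: min_tree_assign_root].
exists prim_prog, 100%N => T P s.
(* A potential graph has a vertex, so there is one with number 0 to start from. *)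
apply: (@prim_prog_runs _ _ _ (enum_val (Ordinal (vertices_neq0 P)))).
by rewrite enum_valK.
Qed.
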